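(* Let $N=\{1,\dots,n\}$, let $K$ be a finite index set, let $A_k\subseteq N$ for $k\in K$ with $\bigcup_{k\in K}A_k=N$, and let $E\subseteq\{(i,j)\in N\times N\mid i\le j\}$. Suppose that $A_k\cap A_l=\emptyset$ for all $k,l\in K$ with $k\ne l$. Consider the following system of linear constraints in the variables $f_{ij}$ ($1\le i\le j\le n$) and $z_{ik}$ ($i\in N$, $k\in K$): $$\begin{aligned} f_{ij}&=1 &&\text{for all }(i,j)\in E,\\ f_{ij}-z_{jk}&\ge 0 &&\text{for all }k\in K,\ i\in A_k,\ j\in N,\ i\le j,\\ f_{ji}-z_{jk}&\ge 0 &&\text{for all }k\in K,\ i\in A_k,\ j\in N,\ j<i,\\ \sum_{k\in K:\,i\in A_k}z_{jk}-f_{ij}&\ge 0 &&\text{for all }1\le i\le j\le n,\\ \sum_{k\in K:\,j\in A_k}z_{ik}-f_{ij}&\ge 0 &&\text{for all }1\le i\le j\le n. \end{aligned}$$ Then the coefficient matrix of this system (one row per constraint, one column per variable) is totally unimodular.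
   Context: A matrix is totally unimodular if every square submatrix has determinant in $\{-1,0,1\}$. The system is the constraint system of the mixed-integer program that minimizes $w_{eqn}\sum_{k\in K}\sum_{i=1}^n z_{ik}+w_{var}\sum_{1\le i\le j\le n}f_{ij}$ subject to the constraints $f_{ij}=1$ for all $(i,j)\in E$; $f_{ij}\ge z_{jk}$ for all $k\in K$, $i\in A_k$, $j\in N$ with $i\le j$; $f_{ji}\ge z_{jk}$ for all $k\in K$, $i\in A_k$, $j\in N$ with $j<i$; $\sum_{k\in K:\,i\in A_k}z_{jk}\ge f_{ij}$ and $\sum_{k\in K:\,j\in A_k}z_{ik}\ge f_{ij}$ for all $1\le i\le j\le n$; together with $f_{ij}\in[0,1]$ and $z_{ik}\in\{0,1\}$. Here $z_{ik}=1$ encodes $i\in B_k$ and $f_{ij}=1$ encodes $(i,j)\in F$, where the sets $B_k\subseteq N$ and $F$ are to be chosen for a compact linearization of a binary quadratic program with products indexed by $E$ and assignment constraints $\sum_{i\in A_k}x_i=1$, $k\in K$. *)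

(* Defs.v *)
From mathcomp Require Import all_boot all_order all_algebra.

Set Implicit Arguments.
Unset Strict Implicit.
Unset Printing Implicit Defensive.

Import GRing.Theory Num.Theory.
Local Open Scope ring_scope.

(* A submatrix is selected by injections of row and column indices; that these
   need not be increasing only affects the sign of the determinant. *)
Definition totally_unimodular (R : comNzRingType) (m n : nat)
    (M : 'M[R]_(m, n)) : Prop :=
  forall (p : nat) (r : 'I_p -> 'I_m) (c : 'I_p -> 'I_n),
    injective r -> injective c -> \det (mxsub r c M) \in [:: -1; 0; 1].

(* N = {1, ..., n} is represented by 'I_n, shifting indices by one. *)
Definition ordered_pair (n : nat) : finType :=
  {p : 'I_n * 'I_n | (p.1 <= p.2)%N}.

Definition fst_idx n (p : ordered_pair n) : 'I_n := (val p).1.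
Definition snd_idx n (p : ordered_pair n) : 'I_n := (val p).2.

(* inl (i, j) is the variable f_ij, i <= j, and inr (i, k) the variable z_ik. *)
Definition variable (n : nat) (K : finType) : finType :=
  (ordered_pair n + 'I_n * K)%type.

Section System.

Variables (n : nat) (K : finType) (A : K -> {set 'I_n}).
Variable E : {set ordered_pair n}.

(* The triples (k, i, j) with i \in A_k and i <= j, encoded as (k, (i, j)). *)
Definition upper_triple : finType :=
  {t : K * ordered_pair n | fst_idx t.2 \in A t.1}.

(* The triples (k, i, j) with i \in A_k and j < i, encoded as (k, (j, i)). *)
Definition lower_triple : finType :=
  {t : K * ordered_pair n |
    (snd_idx t.2 \in A t.1) && (fst_idx t.2 < snd_idx t.2)%N}.

Definition constraint : finType :=
  ({p : ordered_pair n | p \in E} +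
   (upper_triple + (lower_triple + (ordered_pair n + ordered_pair n))))%type.

Definition lhs (R : pzRingType) (x : variable n K -> R) (r : constraint) : R :=
  let f p := x (inl p) in
  let z i k := x (inr (i, k)) in
  match r with
  (* f_ij = 1 *)
  | inl e => f (val e)
  (* f_ij - z_jk >= 0 *)
  | inr (inl t) =>
      let: (k, p) := val t in f p - z (snd_idx p) k
  (* f_ji - z_jk >= 0, where p = (j, i) *)
  | inr (inr (inl t)) =>
      let: (k, p) := val t in f p - z (fst_idx p) k
  (* \sum_(k | i \in A_k) z_jk - f_ij >= 0 *)
  | inr (inr (inr (inl p))) =>
      \sum_(k | fst_idx p \in A k) z (snd_idx p) k - f p
  (* \sum_(k | j \in A_k) z_ik - f_ij >= 0 *)
  | inr (inr (inr (inr p))) =>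
      \sum_(k | snd_idx p \in A k) z (fst_idx p) k - f p
  end.

(* The coefficient of a variable v in a linear form is the value of that form
   at the v-th unit vector; see lhsE. *)
Definition coef_matrix (R : pzRingType) : 'M[R]_(#|constraint|, #|variable n K|) :=
  \matrix_(r, c) lhs (fun v => (v == enum_val c)%:R) (enum_val r).

Lemma lhsE (R : pzRingType) (x : variable n K -> R) (r : 'I_#|constraint|) :
  lhs x (enum_val r) = \sum_c coef_matrix R r c * x (enum_val c).
Proof.
transitivity (\sum_v lhs (fun w => (w == v)%:R) (enum_val r) * x v); last first.
  rewrite (reindex (@enum_val _ (variable n K))) /=; last exact/onW_bij/enum_val_bij.
  by apply: eq_bigr => c _; rewrite mxE.
have delta w : \sum_v (w == v)%:R * x v = x w.
  rewrite (bigD1 w) //= eqxx mul1r big1 ?addr0 // => v /negPf nvw.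
  by rewrite eq_sym nvw mul0r.
have dsum (P : pred K) i :
    \sum_(v : variable n K) (\sum_(k | P k) (inr (i, k) == v)%:R) * x v =
    \sum_(k | P k) x (inr (i, k)).
  under eq_bigr do rewrite mulr_suml.
  by rewrite exchange_big /=; apply: eq_bigr => k _; apply: delta.
symmetry; case: (enum_val r) => [e|[t|[t|[p|p]]]] /=; first by rewrite delta.
- case: (val t) => k p /=; under eq_bigr do rewrite mulrBl.
  by rewrite sumrB !delta.
- case: (val t) => k p /=; under eq_bigr do rewrite mulrBl.
  by rewrite sumrB !delta.
- by under eq_bigr do rewrite mulrBl; rewrite sumrB delta dsum.
- by under eq_bigr do rewrite mulrBl; rewrite sumrB delta dsum.
Qed.

End System.

(* Main.v *)
(** Since the sets [A k] partition [N], each sum over [k] with [i \in A k]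
    consists of a single variable, so every row of the system has at most one
    entry 1, at most one entry -1, and zeros elsewhere.  A square matrix [M] of
    this shape has determinant in {-1, 0, 1}: either every row sums to zero and
    [M] is singular, or some row has a single nonzero entry, and Laplace
    expansion along it reduces to a smaller matrix of the same shape. *)
Require Import Defs.
From mathcomp Require Import all_boot all_order all_algebra.

Set Implicit Arguments.
Unset Strict Implicit.
Unset Printing Implicit Defensive.

Import GRing.Theory.
Local Open Scope ring_scope.

(* Labelling the columns injectively in a larger type [T], instead of naming
   them, makes this property hereditary for submatrices: a label [a] or [b]
   outside the range of [lab] stands for an absent entry. *)
Definition signed_incidence_row (R : pzRingType) (T : eqType) (p : nat)
    (lab : 'I_p -> T) (row : 'I_p -> R) : Prop :=
  exists a b : T, forall j, row j = (a == lab j)%:R - (b == lab j)%:R.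

Lemma sum_eq_label (R : pzRingType) (T : eqType) (p : nat)
    (lab : 'I_p -> T) (a : T) :
  injective lab -> \sum_j (a == lab j)%:R = (a \in codom lab)%:R :> R.
Proof.
move=> lab_inj; case: (boolP (a \in codom lab)) => [/codomP[j0 ->]|a_out].
  rewrite (bigD1 j0) //= eqxx big1 ?addr0 // => j /negPf jj0.
  by rewrite (inj_eq lab_inj) eq_sym jj0.
rewrite big1 // => j _; case: eqP => // a_j.
by rewrite a_j codom_f in a_out.
Qed.

(** The all-ones vector is in the kernel of [M]; multiplying by [\adj M] turns this into [\det M]
    times that vector being zero, without any division in [R]. *)
Lemma det_row_sum0 (R : comPzRingType) (p : nat) (M : 'M[R]_p.+1) :
  (forall i, \sum_j M i j = 0) -> \det M = 0.
Proof.
move=> M0; have M1 : M *m (const_mx 1 : 'cV_p.+1) = 0.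
  apply/matrixP => i j; rewrite !mxE -[RHS](M0 i).
  by apply: eq_bigr => k _; rewrite mxE mulr1.
have := mulmxA (\adj M) M (const_mx 1 : 'cV_p.+1).
rewrite M1 mulmx0 mul_adj_mx mul_scalar_mx => /matrixP/(_ ord0 ord0).
by rewrite !mxE mulr1.
Qed.

Lemma det_row_single (R : comPzRingType) (p : nat) (M : 'M[R]_p.+1)
    (i0 j0 : 'I_p.+1) :
  (forall j, j != j0 -> M i0 j = 0) ->
  \det M = M i0 j0 * ((-1) ^+ (i0 + j0) * \det (row' i0 (col' j0 M))).
Proof.
move=> M0; rewrite (expand_det_row _ i0) (bigD1 j0) //= big1 ?addr0 //.
by move=> j /M0 ->; rewrite mul0r.
Qed.

Lemma sign_mulr_mem (R : pzRingType) (n : nat) (x : R) :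
  x \in [:: -1; 0; 1] -> (-1) ^+ n * x \in [:: -1; 0; 1].
Proof.
rewrite !inE -signr_odd; case: odd; rewrite ?expr1 ?expr0 ?mulN1r ?mul1r //.
by case/or3P => /eqP ->; rewrite ?opprK ?oppr0 eqxx ?orbT.
Qed.

Lemma det_signed_incidence (R : comNzRingType) (T : eqType) (p : nat)
    (lab : 'I_p -> T) (M : 'M[R]_p) :
  injective lab -> (forall i, signed_incidence_row lab (M i)) ->
  \det M \in [:: -1; 0; 1].
Proof.
elim: p lab M => [|p IHp] lab M lab_inj rowM.
  by rewrite det_mx00 !inE eqxx !orbT.
have minorM i0 j0 : \det (row' i0 (col' j0 M)) \in [:: -1; 0; 1].
  apply: (IHp (lab \o lift j0)); first exact: inj_comp lab_inj (@lift_inj _ j0).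
  by move=> i; have [a [b Mi]] := rowM (lift i0 i); exists a, b => j; rewrite !mxE Mi.
(* The two signs to absorb are that of the single entry and that of its cofactor. *)
have single i0 j0 (s : bool) : (forall j, M i0 j = (-1) ^+ s * (j0 == j)%:R) ->
    \det M \in [:: -1; 0; 1].
  move=> Mi0; rewrite (@det_row_single _ _ _ i0 j0) => [|j /negPf j0j].
    by rewrite Mi0 eqxx mulr1; do 2!apply: sign_mulr_mem.
  by rewrite Mi0 eq_sym j0j mulr0.
have outside a j : a \notin codom lab -> (a == lab j) = false.
  by move=> a_out; apply: contraNF a_out => /eqP ->; apply: codom_f.
case: (altP (@forallP _ (fun i => \sum_j M i j == 0))) => [/= M0|].
  by rewrite det_row_sum0 ?inE ?eqxx ?orbT // => i; apply/eqP.
rewrite negb_forall => /existsP[i0]; have [a [b Mi0]] := rowM i0.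
under eq_bigr do rewrite Mi0.
rewrite sumrB !sum_eq_label //.
(* The row sum is 1 or 0 for [a] minus 1 or 0 for [b]. It is nonzero, so exactly one of the two
   labels names a column. *)
have [/codomP[ja a_ja]|a_out] := boolP (a \in codom lab);
  have [/codomP[jb b_jb]|b_out] := boolP (b \in codom lab);
  rewrite ?subrr ?eqxx // => _.
- apply: (single i0 ja false) => j.
  by rewrite Mi0 a_ja (outside b) // (inj_eq lab_inj) subr0 mul1r.
- apply: (single i0 jb true) => j.
  by rewrite Mi0 b_jb (outside a) // (inj_eq lab_inj) sub0r mulN1r.
Qed.

Lemma totally_unimodular_signed_incidence (R : comNzRingType) (T : eqType)
    (m n : nat) (lab : 'I_n -> T) (M : 'M[R]_(m, n)) :
  injective lab -> (forall i, signed_incidence_row lab (M i)) ->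
  totally_unimodular M.
Proof.
move=> lab_inj rowM p r c _ c_inj.
(* Selected columns keep their labels, so the same [a] and [b] serve for the restricted row. *)
apply: (@det_signed_incidence _ _ _ (lab \o c)); first exact: inj_comp.
by move=> i; have [a [b Mi]] := rowM (r i); exists a, b => j; rewrite mxE Mi.
Qed.

(** Covering yields a block containing [i] and disjointness makes it unique; the [pred1] form lets
    [big_pred1] collapse the sums over blocks. *)
Lemma partition_pred1 (T K : finType) (A : K -> {set T}) (i : T) :
  \bigcup_(k : K) A k = [set: T] ->
  (forall k l : K, k <> l -> A k :&: A l = set0) ->
  exists k0, (fun k => i \in A k) =1 pred1 k0.
Proof.
move=> cover_A disjoint_A.
have /bigcupP[k0 _ ik0] : i \in \bigcup_(k : K) A k by rewrite cover_A inE.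
exists k0 => k /=; case: eqP => [-> // | kk0].
apply: contra_eqF (disjoint_A _ _ kk0) => ik.
by apply/set0Pn; exists i; rewrite inE ik.
Qed.

Theorem theorem3p5 (R : realDomainType) (n : nat) (K : finType)
    (A : K -> {set 'I_n}) (E : {set ordered_pair n})
    (cover_A : \bigcup_(k : K) A k = [set: 'I_n])
    (disjoint_A : forall k l : K, k <> l -> A k :&: A l = set0) :
  totally_unimodular (coef_matrix A E R).
Proof.
(* [None] labels the absent -1 in the rows of the equations [f_ij = 1]. *)
apply: (@totally_unimodular_signed_incidence _ (option (variable n K)) _ _
  (Some \o enum_val)); first exact: inj_comp Some_inj enum_val_inj.
have block i := partition_pred1 i cover_A disjoint_A.
move=> i; rewrite /signed_incidence_row.
case Ei: (enum_val i) => [e|[t|[t|[p|p]]]].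
- by exists (Some (inl (val e))), None => j; rewrite mxE Ei /= subr0.
- case Et: (val t) => [k p].
  by exists (Some (inl p)), (Some (inr (snd_idx p, k))) => j; rewrite mxE Ei /= Et.
- case Et: (val t) => [k p].
  by exists (Some (inl p)), (Some (inr (fst_idx p, k))) => j; rewrite mxE Ei /= Et.
- have [k Ak] := block (fst_idx p).
  exists (Some (inr (snd_idx p, k))), (Some (inl p)) => j.
  by rewrite mxE Ei /= (big_pred1 k).
- have [k Ak] := block (snd_idx p).
  exists (Some (inr (fst_idx p, k))), (Some (inl p)) => j.
  by rewrite mxE Ei /= (big_pred1 k).
Qed.
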